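(* Let $p \in (0,1)$ and suppose $c_p$ is a constant such that $\mathbb{E}[\chi(G_p)] \geq c_p\cdot\chi(G)^p$ for all graphs $G$. Then $c_p \leq 2\cdot 3^{-p}$. In particular, for $p = 2/3$ such a constant must satisfy $c_p < 1$.
   Context: Graphs are finite and simple; $\chi$ denotes the chromatic number. For a graph $G$ and $p\in[0,1]$, $G_p$ denotes the random subgraph of $G$ on the vertex set $V(G)$ obtained by keeping each edge of $G$ independently with probability $p$. *)

(* Defs.v *)
From HB Require Import structures.
From mathcomp Require Import all_boot all_order all_algebra.
From mathcomp Require Import reals exp.

Set Implicit Arguments.
Unset Strict Implicit.
Unset Printing Implicit Defensive.

Import Order.TTheory GRing.Theory Num.Theory.

Record sgraph := SGraph {
  vertex :> finType;
  adj : rel vertex;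
  adj_sym : symmetric adj;
  adj_irr : irreflexive adj }.

Definition proper_coloring (G : sgraph) (k : nat) (f : {ffun G -> 'I_k}) : bool :=
  [forall x : G, forall y : G, adj x y ==> (f x != f y)].

Definition colorable (G : sgraph) (k : nat) : bool :=
  [exists f : {ffun G -> 'I_k}, proper_coloring f].

Lemma colorable_exists (G : sgraph) : exists k, colorable G k.
Proof.
exists #|G|; apply/existsP; exists [ffun x => enum_rank x].
apply/forallP => x; apply/forallP => y; apply/implyP => xy.
rewrite !ffunE (inj_eq enum_rank_inj); apply: contraTneq xy => ->.
by rewrite adj_irr.
Qed.

Definition chi (G : sgraph) : nat := ex_minn (colorable_exists G).

Definition edges (G : sgraph) : {set {set G}} :=
  [set [set xy.1; xy.2] | xy : G * G & adj xy.1 xy.2].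

Section SpanningSubgraph.
Variables (G : sgraph) (F : {set {set G}}).

Definition sub_adj : rel G := [rel x y | adj x y && ([set x; y] \in F)].

Lemma sub_adj_sym : symmetric sub_adj.
Proof. by move=> x y; rewrite /sub_adj /= adj_sym setUC. Qed.

Lemma sub_adj_irr : irreflexive sub_adj.
Proof. by move=> x; rewrite /sub_adj /= adj_irr. Qed.

Definition spanning_subgraph : sgraph := SGraph sub_adj_sym sub_adj_irr.

End SpanningSubgraph.

Local Open Scope ring_scope.

(* The probability that the edge set of G_p is exactly F, for F a subset of
   edges G: the edges are kept independently, so it is a product over edges. *)
Definition percolation_prob (R : realType) (p : R) (G : sgraph)
    (F : {set {set G}}) : R :=
  \prod_(e in edges G) (if e \in F then p else 1 - p).

(* Expectation of X(G_p). The sample space is the finite set of subsets of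
   edges G. *)
Definition percolation_expect (R : realType) (p : R) (G : sgraph)
    (X : sgraph -> R) : R :=
  \sum_(F in powerset (edges G))
    percolation_prob p F * X (spanning_subgraph F).

(* Main.v *)
(** Test the inequality on the odd cycles [C_n], whose chromatic number is 3.
    Removing any edge from [C_n] leaves a bipartite graph, so [chi (G_p) <= 2]
    unless all edges survive, and [E[chi (G_p)] <= 2 + p^e] with [e] the number
    of edges.  Letting [n] tend to infinity gives [c * 3^p <= 2]. *)

Require Import Defs.
From mathcomp Require Import all_boot all_order all_algebra.
From mathcomp Require Import reals exp.
From mathcomp Require Import zify ring lra.
From mathcomp Require Import topology normedtype sequences.

Set Implicit Arguments.
Unset Strict Implicit.
Unset Printing Implicit Defensive.

Import Order.TTheory GRing.Theory Num.Theory.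
Local Open Scope ring_scope.

Section Coloring.
Local Open Scope nat_scope.

(** Colours as plain natural numbers let one function serve for different numbers of colours and be
    given by arithmetic formulas. *)
Lemma colorableP (G : sgraph) (k : nat) :
  reflect (exists2 f : G -> nat, forall x, f x < k &
             forall x y, adj x y -> f x != f y)
          (colorable G k).
Proof.
apply: (iffP existsP) => [[f /forallP fP]|[f fk fP]].
  exists (fun x => f x : nat) => [x|x y xy]; first exact: ltn_ord.
  by have /forallP/(_ y)/implyP/(_ xy) := fP x.
exists [ffun x => Ordinal (fk x)].
apply/forallP => x; apply/forallP => y; apply/implyP => xy.
by rewrite !ffunE -val_eqE /=; apply: fP.
Qed.

Lemma colorableW (G : sgraph) (k m : nat) :
  k <= m -> colorable G k -> colorable G m.
Proof.
move=> km /colorableP[f fk fP]; apply/colorableP; exists f => // x.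
exact: leq_trans (fk x) km.
Qed.

Lemma chi_leq (G : sgraph) (k : nat) : (chi G <= k) = colorable G k.
Proof.
rewrite /chi; case: ex_minnP => m Gm min_m.
by apply/idP/idP => [mk|/min_m//]; apply: colorableW Gm.
Qed.

Lemma colorable_spanning (G : sgraph) (F : {set {set G}}) (k : nat) :
  colorable G k -> colorable (spanning_subgraph F) k.
Proof.
move=> /colorableP[f fk fP]; apply/colorableP; exists f => // x y /andP[xy _].
exact: fP.
Qed.

End Coloring.

Section OddCycle.
Local Open Scope nat_scope.
Variable k : nat.
(** This length is odd and at least 3 by construction, and [k = 0] gives the triangle. *)
Let n := k.*2.+3.

Definition cycle_adj : rel 'I_n := [rel x y | (y == ordS x) || (x == ordS y)].

Lemma cycle_adj_sym : symmetric cycle_adj.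
Proof. by move=> x y; rewrite /cycle_adj /= orbC. Qed.

(** Trading the modulus in [ordS] for a case split isolates the one edge that wraps around, from
    [n.-1] to 0. *)
Lemma val_ordS (x : 'I_n) : ordS x = (if x == n.-1 :> nat then 0 else x.+1) :> nat.
Proof.
rewrite /=; case: eqP => [->|xn]; first by rewrite modnn.
by rewrite modn_small //; have := ltn_ord x; rewrite /n in xn *; lia.
Qed.

Lemma eq_ordS (x y : 'I_n) :
  (y == ordS x) = (y == (if x == n.-1 :> nat then 0 else x.+1) :> nat).
Proof. by rewrite -val_ordS. Qed.

Lemma cycle_adj_irr : irreflexive cycle_adj.
Proof.
move=> x; rewrite /cycle_adj /= orbb eq_ordS.
by case: ifP => [/eqP-> //|_]; apply: ltn_eqF.
Qed.

Definition odd_cycle : sgraph := SGraph cycle_adj_sym cycle_adj_irr.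

Lemma colorable_step (F : {set {set odd_cycle}}) (f : 'I_n -> nat) (m : nat) :
  (forall x, f x < m) ->
  (forall x : 'I_n, [set x; ordS x] \in F -> f x != f (ordS x)) ->
  colorable (spanning_subgraph F) m.
Proof.
move=> fm fP; apply/colorableP; exists f => // x y /andP[] /orP[]/eqP->.
  exact: fP.
by rewrite setUC eq_sym; apply: fP.
Qed.

Lemma odd_cycle_colorable3 : colorable odd_cycle 3.
Proof.
(* Parity fails only on the wrap-around edge, whose ends [n.-1] and 0 are both even; the third
   colour goes to [n.-1]. *)
apply/colorableP; pose f (x : 'I_n) := if x == n.-1 :> nat then 2 else odd x : nat.
have f_step (x : 'I_n) : f x != f (ordS x).
  rewrite /f val_ordS; case: (eqVneq (x : nat) n.-1) => [_|] //=.
  by case: ifP => _; case: (odd x).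
exists f => [x|x y /orP[]/eqP->]; rewrite ?f_step // 1?eq_sym ?f_step //.
by rewrite /f; case: eqP => _; case: odd.
Qed.

(* The remaining path is coloured by parity, with the colours swapped after the
   missing edge; this is consistent at [0] since the length [n] is odd. *)
Lemma odd_cycle_minus_edge (F : {set {set odd_cycle}}) (x0 : 'I_n) :
  [set x0; ordS x0] \notin F -> colorable (spanning_subgraph F) 2.
Proof.
move=> x0F; pose f (x : 'I_n) := odd x (+) (x0 < x) : nat.
apply: (@colorable_step _ f) => [x|x xF]; first by rewrite /f; case: (_ (+) _).
have xx0 : x != x0 :> nat.
  by apply: contraNneq x0F => /val_inj <-.
rewrite /f val_ordS; case: ifP => [/eqP xn|_] /=.
  have -> : x0 < x by have := ltn_ord x0; move: xx0; rewrite xn /n => /eqP; lia.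
  by rewrite xn /= odd_double.
have -> : (x0 < x.+1) = (x0 < x) by lia.
by case: (odd x); case: (x0 < x).
Qed.

(** Two colours must alternate along the path from 0, so the even vertex [n.-1] gets the colour of
    its neighbour 0. *)
Lemma odd_cycle_not_colorable2 : ~~ colorable odd_cycle 2.
Proof.
apply/negP => /colorableP[f f2 fP].
have alt i : i < n -> f (inord i) = odd i (+) (f ord0 == 1) :> nat.
  elim: i => [_|i IHi lt_i].
    have -> : inord 0 = ord0 :> 'I_n by apply/val_inj; rewrite /= inordK.
    by have := f2 ord0; case: (f ord0) => [|[|]].
  have := fP (inord i) (inord i.+1).
  rewrite IHi ?(ltnW lt_i) //; set b := f ord0 == 1.
  have -> : adj (inord i : odd_cycle) (inord i.+1).
    apply/orP; left; rewrite eq_ordS !inordK ?(ltnW lt_i) //.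
    by rewrite ifN /= ?eqxx // neq_ltn -ltnS lt_i.
  move=> /(_ isT) /=; have := f2 (inord i.+1).
  by case: (f _) => [|[|]] //; case: (odd i); case: b.
have := fP (inord n.-1) ord0; rewrite alt // /= odd_double /=.
have -> : cycle_adj (inord n.-1) ord0.
  by apply/orP; left; rewrite eq_ordS inordK //= eqxx.
by move=> /(_ isT); have := f2 ord0; case: (f ord0) => [|[|]].
Qed.

Lemma chi_odd_cycle : chi odd_cycle = 3.
Proof.
apply/eqP; rewrite eqn_leq chi_leq odd_cycle_colorable3 /=.
by rewrite ltnNge chi_leq odd_cycle_not_colorable2.
Qed.

Lemma edges_odd_cycle_sub (F : {set {set odd_cycle}}) :
  (forall x : 'I_n, [set x; ordS x] \in F) -> edges odd_cycle \subset F.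
Proof.
move=> allF; apply/subsetP => e /imsetP[[x y] /= + ->].
by rewrite inE /= => /orP[]/eqP->; [|rewrite setUC]; apply: allF.
Qed.

Lemma chi_spanning_odd_cycle (F : {set {set odd_cycle}}) :
  F \subset edges odd_cycle ->
  chi (spanning_subgraph F) <= 2 + (F == edges odd_cycle).
Proof.
move=> FE; rewrite chi_leq; case: eqP => [_|/eqP FneE].
  exact/colorable_spanning/odd_cycle_colorable3.
have [allF|/forallPn[x0]] := boolP [forall x : 'I_n, [set x; ordS x] \in F].
  by rewrite eqEsubset FE edges_odd_cycle_sub // in FneE; apply/forallP.
exact: odd_cycle_minus_edge.
Qed.

(** The edges cover all [n] vertices and each has at most two, so [n <= 2 * #|edges odd_cycle|]. A
    bound growing with [k] suffices, since it only serves to make the probability that all edges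
    survive tend to 0. *)
Lemma card_edges_odd_cycle : k < #|edges odd_cycle|.
Proof.
suff : n <= 2 * #|edges odd_cycle| by rewrite /n; lia.
have cov : [set: 'I_n] \subset cover (edges odd_cycle).
  apply/subsetP => x _; apply/bigcupP; exists [set x; ordS x].
    by apply/imsetP; exists (x, ordS x) => //; rewrite inE; apply/orP; left; exact: eqxx.
  by rewrite !inE eqxx.
rewrite -[X in X <= _]card_ord -cardsT (leq_trans (subset_leq_card cov)) //.
rewrite (leq_trans (leq_card_cover _)) // mulnC -sum_nat_const leq_sum //.
move=> e /imsetP[[x y] _ ->]; rewrite cards2; by case: (_ != _).
Qed.

End OddCycle.

Section Percolation.
Variables (R : realType) (p : R) (G : sgraph).

Lemma percolation_prob_sum :
  \sum_(F in powerset (edges G)) percolation_prob p F = 1 :> R.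
Proof.
(* Expanding this product gives one term for each family [F] of vertex sets; the factor 0 at
   non-edges kills every [F] not contained in [edges G]. *)
have <- : \prod_(e : {set G}) ((if e \in edges G then p else 0) +
                    (if e \in edges G then 1 - p else 1)) = 1 :> R.
  by apply: big1 => e _; case: ifP => _; ring.
rewrite bigA_distr /= big_mkcond [RHS]big_mkcond /=; apply: eq_bigr => F _.
rewrite powersetE; case: ifPn => [FE|/subsetPn[e eF eE]].
  rewrite /percolation_prob big_mkcond; apply: eq_bigr => e _ /=.
  case: (boolP (e \in edges G)) => [//|eE].
  by rewrite ifN //; apply: contra eE; apply: (subsetP FE).
by rewrite (bigD1 e) //= eF (negbTE eE) mul0r.
Qed.

Lemma percolation_prob_edges :
  percolation_prob p (edges G) = p ^+ #|edges G|.
Proof. by rewrite /percolation_prob (eq_bigr (fun=> p)) ?prodr_const// => e ->. Qed.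

Lemma percolation_prob_ge0 (F : {set {set G}}) :
  0 <= p <= 1 -> 0 <= percolation_prob p F.
Proof.
by move=> /andP[p0 p1]; apply: prodr_ge0 => e _; case: ifP => _; rewrite ?subr_ge0.
Qed.

(** Linearity of expectation: the total mass is 1, and the indicator contributes the probability
    that every edge survives. *)
Lemma percolation_expect_all_edges (a : R) :
  \sum_(F in powerset (edges G)) percolation_prob p F * (a + (F == edges G)%:R)
  = a + p ^+ #|edges G|.
Proof.
under eq_bigr do rewrite mulrDr.
rewrite big_split /= -mulr_suml percolation_prob_sum mul1r; congr (_ + _).
rewrite (bigD1 (edges G)) ?powersetE //= eqxx mulr1 percolation_prob_edges.
by rewrite big1 ?addr0 // => F /andP[_ /negbTE ->]; rewrite mulr0.
Qed.

End Percolation.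

Lemma percolation_expect_chi_odd_cycle (R : realType) (p : R) (k : nat) :
  0 <= p <= 1 ->
  percolation_expect p (odd_cycle k) (fun H => (chi H)%:R) <= 2 + p ^+ k.
Proof.
move=> p01; set G := odd_cycle k.
apply: (@le_trans _ _ (2 + p ^+ #|edges G|)); last first.
  rewrite lerD2l; apply: ler_wiXn2l; [by lra|by lra|].
  exact/ltnW/card_edges_odd_cycle.
rewrite -percolation_expect_all_edges.
apply: ler_sum => F; rewrite powersetE => FE.
apply: ler_wpM2l; first exact: percolation_prob_ge0.
by rewrite -natrD ler_nat; apply: chi_spanning_odd_cycle.
Qed.

Theorem mainTheorem6 (R : realType) (p c : R) (hp0 : 0 < p) (hp1 : p < 1)
  (hc : forall G : sgraph,
     c * (chi G)%:R `^ p <= percolation_expect p G (fun H => (chi H)%:R)) :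
  c <= 2 * 3 `^ (- p) /\ (p = 2 / 3 -> c < 1).
Proof.
have /cvg_expr pk0 : `|p| < 1 by rewrite gtr0_norm.
have c3 : c * 3 `^ p <= 2.
  (* The cycles give [c * 3 ^ p - 2 <= p ^ k] for every [k], and the right side tends to 0. *)
  rewrite -subr_le0; apply: (cvgr_to_ge pk0); near=> k.
  have p01 : 0 <= p <= 1 by lra.
  have := le_trans (hc (odd_cycle k)) (percolation_expect_chi_odd_cycle k p01).
  by rewrite chi_odd_cycle; lra.
have c_le : c <= 2 * 3 `^ (- p) by rewrite powRN ler_pdivlMr ?powR_gt0.
split=> // p23; apply: le_lt_trans c_le _.
rewrite powRN ltr_pdivrMr ?powR_gt0 // mul1r.
(* The remaining goal is [2 < 3 ^ p]; cubing turns it into [8 < 9]. *)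
have cube : (3 `^ p) ^+ 3 = 3 ^+ 2 :> R.
  rewrite -powR_mulrn ?powR_ge0 // -powRrM p23 divfK ?pnatr_eq0 //.
  exact: powR_mulrn.
by rewrite -(@ltr_pXn2r _ 3) ?nnegrE ?powR_ge0 // cube; lra.
Unshelve. all: by end_near.
Qed.
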